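(* Let $k\ge 0$ be an integer, let $0=t_0<t_1<\dots<t_N=T$ be a partition of $[0,T]$, and set $I_n:=(t_{n-1},t_n)$. Let $u_h^{\rm DG}$ be a discontinuous Galerkin approximation of degree $k$, with upwinding numerical trace $\widehat{u}_h^{\,\rm DG}$, to the solution of $\frac{d}{dt}u(t)=f(t,u(t))$ on $(0,T)$, $u(0)=u_0$, and let $u_h^{{\rm DG},*}$ be its elementwise post-processing, both as defined in the context. Then: (a) $u_h^{{\rm DG},*}|_{I_n}\in\mathcal{P}_{k+1}(I_n)$ for every $n=1,\dots,N$; (b) $u_h^{{\rm DG},*}\in\mathcal{C}^0[0,T]$, that is, $u_h^{{\rm DG},*}$ extends from $\bigcup_n I_n$ to a continuous function on $[0,T]$; (c) $u_h^{{\rm DG},*}(t_\ell)=\widehat{u}_h^{\,\rm DG}(t_\ell)$ for every $\ell=0,\dots,N$, where $u_h^{{\rm DG},*}(t_\ell)$ is the value of the continuous extension (the common value of the one-sided limits at $t_\ell$ from within $[0,T]$).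
   Context: For an integer $m\ge 0$, $\mathcal{P}_m(I_n)$ is the space of real polynomials of degree at most $m$ on $I_n$. For a piecewise polynomial $w$, $w(t_m^{\pm})$ denote the one-sided limits at $t_m$. The function $f$ is real-valued on $[0,T]\times\mathbb{R}$, $u_0\in\mathbb{R}$, and the integrals involving $f$ below are assumed to be well defined. DG method of degree $k$. The function $u_h^{\rm DG}$ satisfies $u_h^{\rm DG}|_{I_n}\in\mathcal{P}_k(I_n)$ for $n=1,\dots,N$. Set $u_h^{\rm DG}(0^-):=u_0$ and define the upwinding numerical trace, at the nodes only, by $\widehat{u}_h^{\,\rm DG}(t_m):=u_h^{\rm DG}(t_m^-)$ for $m=0,\dots,N$; by convention $\widehat{u}_h^{\,\rm DG}(t_m^{\pm}):=\widehat{u}_h^{\,\rm DG}(t_m)$. For each $n=1,\dots,N$, $u_h^{\rm DG}$ satisfies, for all $v\in\mathcal{P}_k(I_n)$, $$-\int_{I_n}u_h^{\rm DG}(t)\,\frac{d}{dt}v(t)\,dt+\widehat{u}_h^{\,\rm DG}(t_n)\,v(t_n^-)-\widehat{u}_h^{\,\rm DG}(t_{n-1})\,v(t_{n-1}^+)=\int_{I_n}f(t,u_h^{\rm DG}(t))\,v(t)\,dt.$$ Scaled left-Radau polynomial. With $P_\ell$ the Legendre polynomial of degree $\ell$ on $[-1,1]$ (normalized by $P_\ell(1)=1$), let $R_{k+1}(\tau):=\tfrac12P_{k+1}(-1)P_{k+1}(\tau)+\tfrac12P_k(-1)P_k(\tau)$ and $\mathcal{R}_{n,k+1}(t):=R_{k+1}(\tau_n(t))$,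 where $\tau_n(t):=(2t-(t_n+t_{n-1}))/(t_n-t_{n-1})$. Post-processing. For $t\in I_n$, $n=1,\dots,N$, $$u_h^{{\rm DG},*}(t):=u_h^{\rm DG}(t)+\big(\widehat{u}_h^{\,\rm DG}(t_{n-1})-u_h^{\rm DG}(t_{n-1}^+)\big)\,\mathcal{R}_{n,k+1}(t).$$ *)

(* Defs.v *)
From HB Require Import structures.
From mathcomp Require Import all_boot all_order all_algebra.
From mathcomp Require Import all_classical all_reals all_analysis.

Set Implicit Arguments.
Unset Strict Implicit.
Unset Printing Implicit Defensive.

Import Order.TTheory GRing.Theory Num.Theory.
Import numFieldNormedType.Exports.

Local Open Scope classical_set_scope.
Local Open Scope ring_scope.

Section DG.
Context {R : realType}.
Implicit Types (t : nat -> R) (w u : R -> R) (k n N : nat).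

Definition mesh (T : R) N t : Prop :=
  [/\ (0 < N)%N, t 0%N = 0, t N = T & forall n, (n < N)%N -> t n < t n.+1].

(* Meaningful for 1 <= n. *)
Definition elt t n : set R := `]t n.-1, t n[%classic.

Definition poly_on k (A : set R) w : Prop :=
  exists2 p : {poly R}, (size p <= k.+1)%N & forall x, A x -> w x = p.[x].

Definition limL w (a : R) : R := lim (w x @[x --> a^'-]).
Definition limR w (a : R) : R := lim (w x @[x --> a^'+]).

(* The upwind trace, indexed by the node number m rather than the node t m; the
   case m = 0 is the convention u(0^-) = u0. *)
Definition upwind (u0 : R) t u (m : nat) : R :=
  if m is 0%N then u0 else limL u (t m).

(* The values of u at the nodes and outside ]0, T[ are irrelevant. The
   integrability clause is the requirement that the integrals involving f be
   well defined; without it [Rintegral] would return a default value. *)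
Definition DG_approx (f : R -> R -> R) (u0 : R) N t k u : Prop :=
  forall n, (1 <= n <= N)%N ->
  [/\ poly_on k (elt t n) u,
      (forall v : {poly R}, (size v <= k.+1)%N ->
         lebesgue_measure.-integrable (elt t n)
           (fun x => (f x (u x) * v.[x])%:E)) &
      (forall v : {poly R}, (size v <= k.+1)%N ->
         - (\int[lebesgue_measure]_(x in elt t n) (u x * v^`().[x]))
         + upwind u0 t u n * limL (horner v) (t n)
         - upwind u0 t u n.-1 * limR (horner v) (t n.-1)
         = \int[lebesgue_measure]_(x in elt t n) (f x (u x) * v.[x]))].

(* Rodrigues' formula; see [legendre1] for the normalization. *)
Definition legendre (l : nat) : {poly R} :=
  ((2 ^ l * l`!)%:R)^-1 *: (('X^2 - 1) ^+ l)^`(l).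

Lemma derivn_XsubC_exp l (q : {poly R}) :
  ((('X - 1%:P) ^+ l * q)^`(l)).[1] = l`!%:R * q.[1].
Proof.
elim: l q => [|l IH] q; first by rewrite expr0 mul1r derivn0 mul1r.
have -> : (('X - 1%:P) ^+ l.+1 * q)^`(l.+1)
        = (('X - 1%:P) ^+ l * (l.+1%:R *: q + ('X - 1%:P) * q^`()))^`(l).
  rewrite derivSn; congr (_^`(l)).
  rewrite derivM deriv_exp derivXsubC mul1r /= exprS scaler_nat.
  by rewrite mulrDr mulrA [_ ^+ l * (_ - _)]mulrC mulrnAl mulrnAr.
by rewrite IH !hornerE subrr mul0r addr0 factS natrM mulrA [_%:R * _%:R]mulrC.
Qed.

Lemma legendre1 l : (legendre l).[1] = 1.
Proof.
rewrite /legendre (_ : 'X^2 - 1 = ('X - 1%:P) * ('X + 1%:P)); last first.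
  by rewrite -subr_sqr -polyC_exp expr1n.
rewrite exprMn hornerZ derivn_XsubC_exp horner_exp hornerD hornerX hornerC.
rewrite natrM natrX [_`!%:R * _]mulrC mulVf // mulf_neq0 ?expf_neq0 ?pnatr_eq0 //.
Qed.

(* [radau k] is R_{k+1}. *)
Definition radau k : {poly R} :=
  (2^-1 * (legendre k.+1).[-1]) *: legendre k.+1
  + (2^-1 * (legendre k).[-1]) *: legendre k.

Definition scaled_radau t n k (x : R) : R :=
  (radau k).[(2 * x - (t n + t n.-1)) / (t n - t n.-1)].

(* [ustar] is specified on the open elements only; its nodal values are
   arbitrary. *)
Definition postprocessing (u0 : R) N t k u (ustar : R -> R) : Prop :=
  forall n, (1 <= n <= N)%N -> forall x, elt t n x ->
    ustar x = u x + (upwind u0 t u n.-1 - limR u (t n.-1)) * scaled_radau t n k x.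

Definition continuous_extension (T : R) N t w (g : R -> R) : Prop :=
  {within `[0, T], continuous g} /\
  (forall n, (1 <= n <= N)%N -> forall x, elt t n x -> g x = w x).

End DG.

(* Main.v *)
Require Import Defs.
From HB Require Import structures.
From mathcomp Require Import all_boot all_order all_algebra.
From mathcomp Require Import all_classical all_reals all_analysis.
Import Order.TTheory GRing.Theory Num.Theory.
Import numFieldNormedType.Exports.
Local Open Scope classical_set_scope.
Local Open Scope ring_scope.

(** The Legendre polynomials satisfy P_l(1) = 1 and, by parity, P_l(-1) = (-1)^l,
    so that R_{k+1}(-1) = 1 and R_{k+1}(1) = 0. Hence on each element the
    post-processing replaces the value u(t_{n-1}^+) by the trace at t_{n-1} and
    leaves the value u(t_n^-), which is the trace at t_n, unchanged. *)

Lemma derivn_comp_polyNX (R : comNzRingType) (p : {poly R}) (l : nat) :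
  (p \Po - 'X)^`(l) = (-1) ^+ l *: (p^`(l) \Po - 'X).
Proof.
elim: l => [|l IH]; first by rewrite expr0 scale1r !derivn0.
rewrite !derivnS IH derivZ deriv_comp derivN derivX mulrN1 scalerN -scaleNr.
by rewrite exprS mulN1r.
Qed.

Lemma legendreN1 (R : realType) (l : nat) : (legendre (R := R) l).[-1] = (-1) ^+ l.
Proof.
rewrite -[RHS]mulr1 -[X in _ * X](legendre1 (R := R) l) /legendre !hornerZ mulrCA.
congr (_ * _); set p := _ ^+ l.
(* The power [p] of ['X^2 - 1] is even. Only the occurrence evaluated at 1 is rewritten: the sign
   produced by the [l] derivatives then meets the one already present, and the two cancel. *)
have {2}-> : p = p \Po - 'X.
  by rewrite /p rmorphXn rmorphB rmorph1 /= comp_Xn_poly sqrrN.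
rewrite derivn_comp_polyNX hornerZ mulrA -exprD addnn -signr_odd odd_double mul1r.
by rewrite horner_comp !hornerE.
Qed.

Lemma size_derivn_leq (R : nzRingType) (p : {poly R}) (l : nat) :
  (size p^`(l) <= size p - l)%N.
Proof.
apply/leq_sizeP => i; rewrite leq_subLR => le_p.
by rewrite coef_derivn nth_default // mul0rn.
Qed.

Lemma size_legendre (R : realType) (l : nat) :
  (size (legendre (R := R) l) <= l.+1)%N.
Proof.
apply: leq_trans (size_scale_leq _ _) _.
apply: leq_trans (size_derivn_leq _ _ _) _.
rewrite leq_subLR addnS addnn.
apply: leq_trans (size_poly_exp_leq _ _) _.
by rewrite size_XnsubC // mul2n.
Qed.

Lemma size_radau (R : realType) (k : nat) : (size (radau (R := R) k) <= k.+2)%N.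
Proof.
apply: leq_trans (size_polyD _ _) _; rewrite geq_max.
by apply/andP; split; apply: leq_trans (size_scale_leq _ _) _;
  apply: leq_trans (size_legendre _ _) _.
Qed.

(** Both Legendre polynomials equal 1 here, while their coefficients carry the consecutive powers of
    -1 and are therefore opposite. *)
Lemma radau1 (R : realType) (k : nat) : (radau (R := R) k).[1] = 0.
Proof.
rewrite /radau; move: (legendre1 (R := R) k) (legendre1 (R := R) k.+1).
move: (legendreN1 R k) (legendreN1 R k.+1).
move: (legendre k) (legendre k.+1) => p q pN qN p1 q1.
rewrite hornerD !hornerZ p1 q1 pN qN exprS.
by rewrite !mulr1 mulN1r mulrN addNr.
Qed.

(** Each coefficient meets the value it was built from, so both signs square to 1 and the two halves
    add up. *)
Lemma radauN1 (R : realType) (k : nat) : (radau (R := R) k).[-1] = 1.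
Proof.
rewrite /radau; move: (legendreN1 R k) (legendreN1 R k.+1).
move: (legendre k) (legendre k.+1) => p q pN qN.
rewrite hornerD !hornerZ pN qN -!mulrA -!expr2.
by rewrite !sqrr_sign !mulr1 -[2^-1]mul1r -splitr.
Qed.

Lemma scaled_radau_poly (R : realType) (t : nat -> R) (n k : nat) :
  exists2 p : {poly R}, (size p <= k.+2)%N & scaled_radau t n k = horner p.
Proof.
set d := (t n - t n.-1)^-1.
(* The affine map onto the reference interval, expanded in ['X]; having degree at most 1, it does
   not raise the degree under composition. *)
pose a : {poly R} := (2 * d) *: 'X - ((t n + t n.-1) * d)%:P.
exists (radau k \Po a).
  apply: leq_trans (size_comp_poly_leq _ _) _; rewrite ltnS.
  have sa : ((size a).-1 <= 1)%N.
    rewrite -subn1 leq_subLR; apply: leq_trans (size_polyD _ _) _.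
    rewrite geq_max size_polyN (leq_trans (size_scale_leq _ _)) ?size_polyX //.
    exact: leq_trans (size_polyC_leq1 _) _.
  rewrite (leq_trans (leq_mul (leqnn _) sa)) // muln1.
  by rewrite -subn1 leq_subLR size_radau.
apply/funext => x; rewrite /scaled_radau horner_comp !hornerE -/d.
by rewrite mulrBl mulrAC.
Qed.

Lemma scaled_radau_right (R : realType) (t : nat -> R) (n k : nat) :
  t n.-1 < t n -> scaled_radau t n k (t n) = 0.
Proof.
move=> lt_t; rewrite /scaled_radau mulr_natl mulr2n opprD addrACA subrr add0r.
by rewrite divff ?radau1 // subr_eq0 gt_eqF.
Qed.

Lemma scaled_radau_left (R : realType) (t : nat -> R) (n k : nat) :
  t n.-1 < t n -> scaled_radau t n k (t n.-1) = 1.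
Proof.
move=> lt_t; rewrite /scaled_radau mulr_natl mulr2n opprD addrACA subrr addr0.
by rewrite -opprB mulNr divff ?radauN1 // subr_eq0 gt_eqF.
Qed.

Section OneSidedLimits.
Context {R : realType} {a b : R} {w g : R -> R}.
Hypotheses (ltab : a < b) (wg : {in `]a, b[, w =1 g}).

(** The one-sided filter at an end point concentrates inside the open interval, so one-sided limits
    can be read off a polynomial piece whatever the nodal values are. *)
Lemma eq_itv_cvg_left {l : R} :
  g x @[x --> b^'-] --> l -> w x @[x --> b^'-] --> l.
Proof.
apply: cvg_trans; apply: near_eq_cvg; near=> x.
apply/esym/wg; rewrite in_itv /=; apply/andP; split; near: x.
- exact: nbhs_left_gt.
- exact: nbhs_left_lt.
Unshelve. all: by end_near. Qed.

Lemma eq_itv_cvg_right {l : R} :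
  g x @[x --> a^'+] --> l -> w x @[x --> a^'+] --> l.
Proof.
apply: cvg_trans; apply: near_eq_cvg; near=> x.
apply/esym/wg; rewrite in_itv /=; apply/andP; split; near: x.
- exact: nbhs_right_gt.
- exact: nbhs_right_lt.
Unshelve. all: by end_near. Qed.

End OneSidedLimits.

Lemma horner_cvg_left {R : realType} (p : {poly R}) (a : R) :
  p.[x] @[x --> a^'-] --> p.[a].
Proof. apply: cvg_at_left_filter; exact: continuous_horner. Qed.

Lemma horner_cvg_right {R : realType} (p : {poly R}) (a : R) :
  p.[x] @[x --> a^'+] --> p.[a].
Proof. apply: cvg_at_right_filter; exact: continuous_horner. Qed.

Lemma mesh_le {R : realType} {T : R} {N : nat} {t : nat -> R} {i j : nat} :
  mesh T N t -> (i <= j)%N -> (j <= N)%N -> t i <= t j.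
Proof.
case=> _ _ _ inc; elim: j => [|j IH]; first by rewrite leqn0 => /eqP->.
rewrite leq_eqVlt => /orP[/eqP-> //|ij] jN.
exact: le_trans (IH ij (ltnW jN)) (ltW (inc j jN)).
Qed.

(* The gluing is done by the formula g(min x c) + p(max x c) - g(c), which avoids
   a case analysis for continuity. *)
Lemma continuous_piecewise_poly (R : realType) (t : nat -> R) (y : nat -> R)
    (P : nat -> {poly R}) (N : nat) :
  (forall n, (n < N)%N -> t n < t n.+1) ->
  (forall n, (n < N)%N -> (P n.+1).[t n] = y n /\ (P n.+1).[t n.+1] = y n.+1) ->
  exists g : R -> R, continuous g /\
    forall n, (1 <= n <= N)%N -> forall x, elt t n x -> g x = (P n).[x].
Proof.
move=> inc Py.
(* Strengthened for the induction: the value at [t N] is needed to attach the next piece, and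
   [t n <= t N] places the earlier elements to the left of the gluing point. *)
suff [g [cg _ gP]] : exists g : R -> R, [/\ continuous g, g (t N) = y N &
    forall n, (1 <= n <= N)%N ->
      t n <= t N /\ forall x, elt t n x -> g x = (P n).[x]].
  by exists g; split=> // n /gP[].
elim: N inc Py => [|N IH] inc Py.
  exists (cst (y 0%N)); split=> //; first exact: cst_continuous.
  by move=> n /andP[n1 /(leq_trans n1)].
have [] := IH (fun n nN => inc n (ltnW nN)) (fun n nN => Py n (ltnW nN)).
move=> g [cg gN gP]; have [PN PN1] := Py N (ltnSn N); have ltN := inc N (ltnSn N).
exists (fun x => g (Num.min x (t N)) + (P N.+1).[Num.max x (t N)] - y N); split.
- move=> x; apply: cvgB; last exact: cvg_cst.
  apply: cvgD.
    apply: (@continuous_comp _ _ _ (fun x => Num.min x (t N)) g); last exact: cg.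
    apply: continuous_min; [exact: cvg_id|exact: cvg_cst].
  apply: (@continuous_comp _ _ _ (fun x => Num.max x (t N)) (horner (P N.+1))).
    apply: continuous_max; [exact: cvg_id|exact: cvg_cst].
  exact: continuous_horner.
- by rewrite (min_idPr (ltW ltN)) (max_idPl (ltW ltN)) gN PN1 addrC addKr.
(* On the new element the minimum is [t N], so [g] contributes [y N]; on an earlier one the maximum
   is [t N], so the new polynomial does. In both cases the subtracted [y N] cancels it. *)
- move=> n /andP[n1]; rewrite leq_eqVlt => /orP[/eqP->|nN].
    split=> // x; rewrite /elt /= in_itv /= => /andP[/ltW Nx _].
    by rewrite (min_idPr Nx) (max_idPl Nx) gN addrC addKr.
  have [tn gn] : t n <= t N /\ forall x, elt t n x -> g x = (P n).[x].
    by apply: gP; rewrite n1.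
  split=> [|x nx]; first exact: le_trans tn (ltW ltN).
  have xN : x <= t N.
    move: (nx); rewrite /elt /= in_itv /= => /andP[_ /ltW xn].
    exact: le_trans xn tn.
  by rewrite (min_idPl xN) (max_idPr xN) PN addrK gn.
Qed.

Theorem proposition3p1 (R : realType) (k N : nat) (T u0 : R) (t : nat -> R)
    (f : R -> R -> R) (u ustar : R -> R)
    (ht : mesh T N t)
    (hu : DG_approx f u0 N t k u)
    (hustar : postprocessing u0 N t k u ustar) :
  (forall n : nat, (1 <= n <= N)%N -> poly_on k.+1 (elt t n) ustar) /\
  (exists g : R -> R, continuous_extension T N t ustar g) /\
  (forall l : nat, (l <= N)%N ->
     [/\ forall g : R -> R, continuous_extension T N t ustar g ->
           g (t l) = upwind u0 t u l,
         (0 < l)%N -> ustar x @[x --> (t l)^'-] --> upwind u0 t u l &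
         (l < N)%N -> ustar x @[x --> (t l)^'+] --> upwind u0 t u l]).
Proof.
have [N0 t0 tN inc] := ht.
(* All the claims follow from this local form: one polynomial per element, taking the trace values
   at both ends. *)
have piece n : (1 <= n <= N)%N -> exists q : {poly R},
    [/\ (size q <= k.+2)%N, forall x, elt t n x -> ustar x = q.[x],
        q.[t n.-1] = upwind u0 t u n.-1 & q.[t n] = upwind u0 t u n].
  case: n => // n nN; have lt_t := inc n nN.
  have [[p sp up] _ _] := hu n.+1 nN.
  have uL : limL u (t n.+1) = p.[t n.+1].
    apply/cvg_lim => //; apply: (eq_itv_cvg_left lt_t up).
    exact: horner_cvg_left.
  have uR : limR u (t n) = p.[t n].
    apply/cvg_lim => //; apply: (eq_itv_cvg_right lt_t up).
    exact: horner_cvg_right.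
  have [r sr rE] := scaled_radau_poly R t n.+1 k.
  (* The left trace enters only through this jump, so the first element, where it is [u0], needs no
     separate case. *)
  set c := upwind u0 t u n - limR u (t n).
  exists (p + c *: r); split.
  - rewrite (leq_trans (size_polyD _ _)) // geq_max (leq_trans sp) //.
    exact: leq_trans (size_scale_leq _ _) sr.
  - move=> x nx; rewrite (hustar n.+1 nN x nx) hornerD hornerZ up //.
    by rewrite rE.
  - rewrite hornerD hornerZ -rE scaled_radau_left // mulr1 /c uR.
    by rewrite addrC subrK.
  - by rewrite hornerD hornerZ -rE scaled_radau_right // mulr0 addr0 /= uL.
have cvL l : (0 < l <= N)%N -> ustar x @[x --> (t l)^'-] --> upwind u0 t u l.
  move=> lN; have [q [_ uq _ <-]] := piece l lN.
  case: l lN uq => // l lN uq.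
  exact: (eq_itv_cvg_left (inc l lN) uq) (horner_cvg_left _ _).
have cvR l : (l < N)%N -> ustar x @[x --> (t l)^'+] --> upwind u0 t u l.
  move=> lN; have [q [_ uq <- _]] := piece l.+1 lN.
  exact: (eq_itv_cvg_right (inc l lN) uq) (horner_cvg_right _ _).
split; [|split].
- by move=> n /piece[q [sq uq _ _]]; exists q.
(* Indices outside 1..N get the polynomial 0. Neighbouring pieces share the trace at their common
   node, which is what allows them to be glued. *)
- have /choice[P PE] : forall n, exists q : {poly R}, (1 <= n <= N)%N ->
      [/\ forall x, elt t n x -> ustar x = q.[x],
          q.[t n.-1] = upwind u0 t u n.-1 & q.[t n] = upwind u0 t u n].
    move=> n; have [/piece[q [_ uq qL qR]]|] := boolP (1 <= n <= N)%N.
      by exists q.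
    by exists 0.
  have [n nN|g [cg gP]] :=
      continuous_piecewise_poly R t (upwind u0 t u) P N inc.
    by have [_ -> ->] := PE n.+1 nN.
  exists g; split; first exact: continuous_subspaceT.
  by move=> n nN x nx; have [uP _ _] := PE n nN; rewrite (gP n nN x nx) uP.
- move=> l lN; split=> [g [cg gu]|l0|]; last 2 first.
  + by apply: cvL; rewrite l0.
  + exact: cvR.
  (* Continuity within [[0, T]] says nothing about [g] outside; restricted to one closed element it
     yields the two inward limits at the ends. *)
  have cgl i (iN : (i < N)%N) :
      g x @[x --> (t i)^'+] --> g (t i) /\ g x @[x --> (t i.+1)^'-] --> g (t i.+1).
    suff /(continuous_within_itvP _ (inc i iN))[_ ? ?] :
      {within `[t i, t i.+1], continuous g} by [].
    apply: continuous_subspaceW cg; rewrite -t0 -tN.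
    apply: subset_itv; rewrite bnd_simp.
      exact: (mesh_le ht (leq0n i) (ltnW iN)).
    exact: (mesh_le ht iN (leqnn N)).
  (* Uniqueness of limits identifies [g (t l)] with the trace, from the right at node 0 and from the
     left at every other node. *)
  case: l lN => [_|l lN].
    apply: (cvg_unique _ _ (cvR 0%N N0)) => //.
    apply: (eq_itv_cvg_right (inc 0%N N0)).
      by move=> x x1; apply/esym/(gu 1%N).
    by have [] := cgl 0%N N0.
  apply: (cvg_unique _ _ (cvL l.+1 lN)) => //.
  apply: (eq_itv_cvg_left (inc l lN)).
    by move=> x x1; apply/esym/(gu l.+1).
  by have [] := cgl l lN.
Qed.
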